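(* Let $L_n$ be as in the context and $n\ge 2$. Every normal automorphism of $L_n$ is inner, where an automorphism is normal if it maps every normal subgroup onto itself.
   Context: For $n\ge 2$, $L_n=\langle y_1,\dots,y_{n-1}\mid y_j^2=1\ (1\le j\le n-1),\ y_iy_{i+1}y_i=y_{i+1}y_iy_{i+1}\ (1\le i\le n-2)\rangle$ (no relations between $y_i,y_j$ with $|i-j|\ge 2$). *)

(* Defs.v *)
From mathcomp Require Import all_boot.
From Stdlib Require Import Relations.

Set Implicit Arguments.
Unset Strict Implicit.
Unset Printing Implicit Defensive.

Definition Lword (n : nat) := seq 'I_n.-1.

Inductive Lstep (n : nat) : Lword n -> Lword n -> Prop :=
| Lstep_sq (a b : Lword n) (i : 'I_n.-1) :
    Lstep (a ++ [:: i; i] ++ b) (a ++ b)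
| Lstep_braid (a b : Lword n) (i j : 'I_n.-1) :
    val j = (val i).+1 ->
    Lstep (a ++ [:: i; j; i] ++ b) (a ++ [:: j; i; j] ++ b).

Definition Leq (n : nat) : relation (Lword n) := clos_refl_sym_trans _ (@Lstep n).

Definition Linv (n : nat) (w : Lword n) : Lword n := rev w.
Definition Lconj (n : nat) (g w : Lword n) : Lword n := g ++ w ++ Linv g.

Definition Lauto (n : nat) (f : Lword n -> Lword n) : Prop :=
  (forall u v, Leq u v -> Leq (f u) (f v)) /\
  (forall u v, Leq (f (u ++ v)) (f u ++ f v)) /\
  exists g : Lword n -> Lword n,
    (forall u v, Leq u v -> Leq (g u) (g v)) /\
    (forall w, Leq (g (f w)) w) /\ (forall w, Leq (f (g w)) w).

Definition Lnormal (n : nat) (N : Lword n -> Prop) : Prop :=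
  (forall u v, Leq u v -> N u -> N v) /\
  N [::] /\
  (forall u v, N u -> N v -> N (u ++ v)) /\
  (forall u, N u -> N (Linv u)) /\
  (forall g u, N u -> N (Lconj g u)).

Definition Lnormal_auto (n : nat) (f : Lword n -> Lword n) : Prop :=
  Lauto f /\
  forall N : Lword n -> Prop, Lnormal N ->
    forall w, N w <-> exists2 v, N v & Leq (f v) w.

Definition Linner (n : nat) (f : Lword n -> Lword n) : Prop :=
  exists g : Lword n, forall w, Leq (f w) (Lconj g w).

(* Main.v *)
(* Write [L_n] as a semidirect product: the free product of [n - 2] copies of
   [Z/3], with generators [c_1, ..., c_(n-2)], extended by an involution [s]
   inverting every [c_k].  The Coxeter generators are the conjugates of [s] by
   the prefixes of the product [c_1 c_2 ... c_(n-2)].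
   An element [w s] with [w] reduced is an involution iff [w] is a palindrome,
   and then it is conjugate to [s]; hence a normal automorphism fixes [s] up to
   an inner one.  The image of [c_k] is then a palindrome of order 3, that is,
   a single letter.  For weights [a_k] in [Z/3], the elements of the free product
   whose total weight is 0 form a normal subgroup of [L_n]: weights supported
   at a single index show that [c_k] is sent to [c_k] or to its inverse, and
   constant weights show that the choice does not depend on [k].  The two
   remaining cases are the identity and conjugation by [s]. *)
From HB Require Import structures.
Require Import Defs.
From mathcomp Require Import all_boot ssralg zmodp zify.
From Stdlib Require Import Relations Setoid Morphisms.

Set Implicit Arguments.
Unset Strict Implicit.
Unset Printing Implicit Defensive.

(** * The group [(Z/3 * ... * Z/3) : Z/2] *)

Section FreeProduct.
Variable m : nat.

Local Notation letter := ('I_m * bool)%type.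
Implicit Types (x y : letter) (u v w : seq letter).

(* [(k, true)] is the generator [c_k] of the [k]-th factor [Z/3] and [(k, false)]
   its inverse, which is also its square. *)
Definition linv x : letter := (x.1, ~~ x.2).

Lemma linvK : involutive linv.
Proof. by case=> k e; rewrite /linv /= negbK. Qed.

Definition other_factor x y := x.1 != y.1.

Definition reduced w := sorted other_factor w.

(** Left multiplication of a reduced word by a letter: two letters of one factor merge, since
    [x x = x^-1], or cancel. *)
Definition lcons x w : seq letter :=
  if w is y :: w' then
    if x.1 == y.1 then if x.2 == y.2 then linv x :: w' else w'
    else x :: w
  else [:: x].

Definition lmul u w := foldr lcons w u.

Definition flip := map linv.

Lemma flipK : involutive flip.
Proof. by move=> w; rewrite /flip mapK //; apply: linvK. Qed.

Lemma reduced_behead x w : reduced (x :: w) -> reduced w.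
Proof. exact: path_sorted. Qed.

Lemma path_flip x w : path other_factor (linv x) w = path other_factor x w.
Proof. by case: w. Qed.

Lemma reduced_flip w : reduced (flip w) = reduced w.
Proof.
by case: w => //= x w; rewrite path_flip; elim: w x => //= y w IH x; rewrite path_flip IH.
Qed.

Lemma reduced_rev w : reduced (rev w) = reduced w.
Proof.
rewrite /reduced rev_sorted; apply: eq_sorted => x y.
by rewrite /other_factor eq_sym.
Qed.

Lemma reduced_lcons x w : reduced w -> reduced (lcons x w).
Proof.
case: w => //= y w yw; case: eqP => [xy|/eqP xy]; last by rewrite /= /other_factor xy.
case: ifP => _; last exact: path_sorted yw.
by rewrite /= path_flip; case: w yw => //= z w; rewrite /other_factor xy.
Qed.

Lemma reduced_lmul u w : reduced w -> reduced (lmul u w).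
Proof. by move=> rw; elim: u => //= x u; apply: reduced_lcons. Qed.

Lemma lcons_reduced x w : reduced (x :: w) -> lcons x w = x :: w.
Proof. by case: w => //= y w /andP[/negbTE ->]. Qed.

Lemma lmul_reduced u w : reduced (u ++ w) -> lmul u w = u ++ w.
Proof.
elim: u => //= x u IH xuw.
by rewrite IH ?lcons_reduced //; apply: path_sorted xuw.
Qed.

Lemma lconsK x w : reduced w -> lcons (linv x) (lcons x w) = w.
Proof.
case: x => k e; case: w => [|[l d] w] rw /=; first by rewrite eqxx; case: e.
case: (eqVneq k l) rw => [<- rw|_ _] /=; last by rewrite eqxx; case: e.
case: (eqVneq e d) rw => [<-|ed] rw /=.
  by rewrite !eqxx /linv /= negbK.
have -> : linv (k, e) = (k, d) by rewrite /linv /=; case: e d ed {rw} => [] [].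
by rewrite lcons_reduced.
Qed.

Lemma lcons2 x w : reduced w -> lcons x (lcons x w) = lcons (linv x) w.
Proof.
case: x => k e; case: w => [|[l d] w] rw /=; first by rewrite !eqxx.
case: (eqVneq k l) rw => [<- rw|_ _] /=; last by rewrite !eqxx.
case: (eqVneq e d) rw => [<-|ed] rw /=.
  by rewrite eqxx; case: e {rw}.
have ed' : ~~ e = d by case: e d ed {rw} => [] [].
by rewrite ed' eqxx linvK lcons_reduced //= -path_flip /linv /= ed'.
Qed.

Lemma lmul_lcons x u w :
  reduced u -> reduced w -> lmul (lcons x u) w = lcons x (lmul u w).
Proof.
case: u => //= y u yu rw; have ru := reduced_lmul u rw.
case: eqP => // xy1; case: eqP => xy2.
  have -> : y = x by case: x y xy1 xy2 {yu} => k e [l d] /= -> ->.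
  by rewrite lcons2.
have -> : x = linv y by case: x y xy1 xy2 {yu} => k [] [l []] //= ->.
by rewrite lconsK.
Qed.

Lemma lmulA u v w :
  reduced v -> reduced w -> lmul u (lmul v w) = lmul (lmul u v) w.
Proof.
by move=> rv rw; elim: u => //= x u IH; rewrite lmul_lcons ?IH //; apply: reduced_lmul.
Qed.

Lemma lmulw0 w : reduced w -> lmul w [::] = w.
Proof. by move=> rw; rewrite lmul_reduced ?cats0. Qed.

Lemma flip_lcons x w : flip (lcons x w) = lcons (linv x) (flip w).
Proof.
case: w => //= y w; case: (x.1 == y.1) => //.
have -> : (~~ x.2 == ~~ y.2) = (x.2 == y.2) by case: x.2 y.2 => [] [].
by case: (x.2 == y.2).
Qed.

Lemma flip_lmul u w : flip (lmul u w) = lmul (flip u) (flip w).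
Proof. by elim: u => //= x u IH; rewrite flip_lcons IH. Qed.

Lemma lmul_revK u w : reduced w -> lmul (rev (flip u)) (lmul u w) = w.
Proof.
move=> rw; elim: u => //= x u IH.
by rewrite rev_cons -cats1 /lmul foldr_cat /= lconsK //; apply: reduced_lmul.
Qed.

Lemma flip_rev w : flip (rev w) = rev (flip w).
Proof. exact: map_rev. Qed.

Lemma lmul_inv u w : reduced w -> lmul u (lmul (rev (flip u)) w) = w.
Proof. by move=> rw; rewrite -{1}(revK u) -{1}(flipK (rev u)) flip_rev lmul_revK. Qed.

(* [(w, b)] stands for the product of [w] and the [b]-th power of the
   involution inverting every letter. *)
Definition star := {p : seq letter * bool | reduced p.1}.
HB.instance Definition _ := Choice.on star.

Definition Star w b (rw : reduced w) : star := exist _ (w, b) rw.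

Definition flip_if (b : bool) w := if b then flip w else w.

Lemma reduced_flip_if b w : reduced (flip_if b w) = reduced w.
Proof. by case: b => //=; apply: reduced_flip. Qed.

Lemma flip_if_lmul b u w : flip_if b (lmul u w) = lmul (flip_if b u) (flip_if b w).
Proof. by case: b => //=; apply: flip_lmul. Qed.

Lemma flip_ifD a b w : flip_if a (flip_if b w) = flip_if (a (+) b) w.
Proof. by case: a b => [] [] //=; rewrite flipK. Qed.

Definition star_one : star := Star false (isT : reduced [::]).

Fact star_mul_subproof (p q : star) :
  reduced (lmul (val p).1 (flip_if (val p).2 (val q).1)).
Proof. by apply: reduced_lmul; rewrite reduced_flip_if; apply: (valP q). Qed.

Definition star_mul p q : star :=
  Star ((val p).2 (+) (val q).2) (star_mul_subproof p q).

Fact star_inv_subproof (p : star) :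
  reduced (flip_if (val p).2 (rev (flip (val p).1))).
Proof. by rewrite reduced_flip_if reduced_rev reduced_flip; apply: (valP p). Qed.

Definition star_inv (p : star) : star := Star (val p).2 (star_inv_subproof p).

Lemma star_mulA : associative star_mul.
Proof.
move=> [[u a] ru] [[v b] rv] [[w c] rw]; apply: val_inj => /=.
by rewrite addbA flip_if_lmul flip_ifD lmulA ?reduced_flip_if.
Qed.

Lemma star_mul1 : left_id star_one star_mul.
Proof. by case=> [[w b] rw]; apply: val_inj. Qed.

Lemma star_mulr1 : right_id star_one star_mul.
Proof.
case=> [[w b] rw]; apply: val_inj => /=.
by rewrite addbF; case: (b); rewrite /= lmulw0.
Qed.

Lemma star_mulV : left_inverse star_one star_inv star_mul.
Proof.
case=> [[w b] /= rw]; apply: val_inj => /=; rewrite addbb -flip_if_lmul.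
by rewrite -{2}(lmulw0 rw) lmul_revK //; case: (b).
Qed.

Lemma star_mulrV : right_inverse star_one star_inv star_mul.
Proof.
case=> [[w b] /= rw]; apply: val_inj => /=; rewrite addbb flip_ifD addbb /=.
by rewrite -[rev _]lmulw0 ?lmul_inv // reduced_rev reduced_flip.
Qed.

HB.instance Definition _ :=
  isGroup.Build star star_mulA star_mul1 star_mulr1 star_mulV star_mulrV.

End FreeProduct.

(** * Its normal automorphisms *)

Section StarAutomorphisms.
Variable m : nat.
Local Open Scope group_scope.

Local Notation letter := ('I_m * bool)%type.
Local Notation star := (star m).
Implicit Types (p q : star) (x : letter) (u w : seq letter).

Definition flipper : star := @Star m [::] true isT.
Definition star_letter x : star := @Star m [:: x] false isT.
Definition star_gen k := star_letter (k, true).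

Lemma flipper2 : flipper * flipper = 1.
Proof. exact: val_inj. Qed.

Lemma flipperV : flipper^-1 = flipper.
Proof. exact: val_inj. Qed.

Lemma star_letterV x : (star_letter x)^-1 = star_letter (linv x).
Proof. exact: val_inj. Qed.

Lemma star_genV k : (star_gen k)^-1 = star_letter (k, false).
Proof. exact: star_letterV. Qed.

Lemma star_letter_sq x : star_letter x * star_letter x = star_letter (linv x).
Proof. by apply: val_inj; rewrite /= !eqxx. Qed.

Lemma star_letterJ x : star_letter x ^ flipper = (star_letter x)^-1.
Proof. exact: val_inj. Qed.

Lemma star_gen_cube k : star_gen k * star_gen k * star_gen k = 1.
Proof. by rewrite star_letter_sq -star_letterV mulVg. Qed.

Lemma star_ind (P : star -> Prop) :
  P 1 -> P flipper -> (forall x p, P p -> P (star_letter x * p)) -> forall p, P p.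
Proof.
move=> P1 Ps Px [[w b] /= rw]; elim: w rw => [|x w IH] rw.
  by case: b rw => rw; [move: Ps|move: P1]; congr P; apply: val_inj.
have /= rw' := reduced_behead rw.
move: (Px x _ (IH rw')); congr P; apply: val_inj => /=.
by rewrite lcons_reduced.
Qed.

(** Inverse letters need no separate hypothesis, being squares of generators. *)
Lemma star_hom_id (F : star -> star) :
  {morph F : p q / p * q} -> F flipper = flipper ->
  (forall k, F (star_gen k) = star_gen k) -> forall p, F p = p.
Proof.
move=> FM Fs Fc.
have F1 : F 1 = 1 by rewrite -flipper2 FM Fs flipper2.
elim/star_ind => // x p IH; rewrite FM IH; congr (_ * _).
case: x => k [|]; first exact: Fc.
have <- : star_gen k * star_gen k = star_letter (k, false).
  exact: star_letter_sq.
by rewrite FM Fc.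
Qed.

(** * Palindromes, involutions and elements of order 3 *)

Lemma reduced_peel x w y : reduced (x :: rcons w y) -> reduced w.
Proof.
move/reduced_behead; rewrite -reduced_rev rev_rcons => /reduced_behead.
by rewrite reduced_rev.
Qed.

Lemma palindromeP w : rev w = w ->
  [\/ w = [::], exists x, w = [:: x]
    | exists x w', w = x :: rcons w' x /\ rev w' = w'].
Proof.
case: w => [|x w] pal; first by constructor 1.
case/lastP: w pal => [|w y]; first by constructor 2; exists x.
rewrite rev_cons rev_rcons rcons_cons => -[->] /rcons_inj[pal].
by constructor 3; exists x, w.
Qed.

(** Equal end letters are peeled off: with [s] the flipper, [s x^-1 = x s], so
    [x w' x s = x (w' s) x^-1]. *)
Lemma palindrome_conj_flipper w (rw : reduced w) : rev w = w ->
  exists h : star, Star true rw = flipper ^ h.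
Proof.
have [n] := ubnP (size w); elim: n w rw => // n IH w rw sz.
case/palindromeP => [w0|[x w0]|[x [w' [w0 pal]]]]; subst w.
- by exists 1; rewrite conjg1; apply: val_inj.
(* Here [x^-1 s x = x^-2 s = x s], as [x] has order 3. *)
- exists (star_letter x); apply: val_inj => /=.
  by rewrite !eqxx linvK.
have [|h def_h] := IH w' (reduced_peel rw) _ pal.
  by rewrite -ltnS; apply: leq_trans sz; rewrite /= size_rcons.
exists (h * (star_letter x)^-1); rewrite conjgM -def_h conjgE invgK mulgA.
apply: val_inj => /=; rewrite linvK lmul_lcons ?(reduced_peel rw) //.
rewrite lmul_reduced; last by rewrite cats1; apply: (reduced_behead rw).
by rewrite cats1 lcons_reduced.
Qed.

(** The inverse of [w s] is [(rev w) s], so an involution of this form has a palindromic word. *)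
Lemma involution_conj_flipper p : (val p).2 -> p * p = 1 ->
  exists h : star, p = flipper ^ h.
Proof.
case: p => [[w b] /= rw]; case: b rw => //= rw _ /mulg1_eq pV.
have pal : rev w = w.
  by move: pV => /(congr1 (fun p => (val p).1)) /=; rewrite flip_rev flipK.
have [h def_h] := palindrome_conj_flipper rw pal.
by exists h; rewrite -def_h; apply: val_inj.
Qed.

(** Conjugation by the flipper gives [flip w] and inversion gives [rev (flip w)], so [w] is a
    palindrome; order 3 then bounds its length. *)
Lemma cube_root_letter p : (val p).2 = false -> p * p * p = 1 ->
  p ^ flipper = p^-1 -> p != 1 -> exists x, p = star_letter x.
Proof.
case: p => [[w b] /= rw] b0; subst b => p3 pV p_neq1.
have pal : rev w = w.
  move: pV => /(congr1 (fun p => flip (val p).1)) /=.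
  by rewrite lmulw0 ?flipK -?flip_rev ?flipK // reduced_flip.
case/palindromeP: pal => [w0|[x w0]|[x [w' [w0 _]]]]; subst w.
- by case/eqP: p_neq1; apply: val_inj.
- by exists x; apply: val_inj.
(* For [w = x w' x], cancellation in [w w] stops at [x x = x^-1], so [w w] is
   longer than [w^-1]. *)
have /(congr1 (fun p => size (val p).1)) : Star false rw * Star false rw =
    (Star false rw)^-1.
  by apply/(mulIg (Star false rw)); rewrite p3 mulVg.
have rbig : reduced (x :: w' ++ linv x :: rcons w' x).
  by rewrite /= cat_path /= path_flip andbA; move: (rw); rewrite /= rcons_path => ->.
have ww : lmul (x :: rcons w' x) (x :: rcons w' x) = x :: w' ++ linv x :: rcons w' x.
  rewrite -cats1 /lmul /= foldr_cat /= !eqxx -/(lmul _ _) cats1.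
  rewrite (@lmul_reduced _ w') ?lcons_reduced //; exact: reduced_behead rbig.
rewrite [LHS](congr1 size ww) /= size_rev /= size_map !(size_cat, size_rcons) /= size_rcons.
lia.
Qed.

(** * Weights in [Z/3] and their kernels *)

Definition letter_weight (a : 'I_m -> 'Z_3) x : 'Z_3 :=
  if x.2 then a x.1 else (- a x.1)%R.

Definition weight a w : 'Z_3 := (\sum_(x <- w) letter_weight a x)%R.

Lemma letter_weightV a x : letter_weight a (linv x) = (- letter_weight a x)%R.
Proof. by case: x => k [] //=; rewrite /letter_weight /= GRing.opprK. Qed.

Lemma Z3_double (t : 'Z_3) : (t + t = - t)%R.
Proof. by case: t => [[|[|[|]]] lt3] //; apply: val_inj. Qed.

Lemma weight_cons a x w : (weight a (x :: w) = letter_weight a x + weight a w)%R.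
Proof. by rewrite /weight big_cons. Qed.

(** Merging two equal letters respects the weight because [2t = -t] in [Z/3]. *)
Lemma weight_lcons a x w : (weight a (lcons x w) = letter_weight a x + weight a w)%R.
Proof.
case: w => [|y w] /=; first by rewrite weight_cons.
case: eqP => xy1; last by rewrite weight_cons.
case: eqP => xy2.
  have -> : y = x by case: x y xy1 xy2 => k e [l d] /= -> ->.
  by rewrite !weight_cons letter_weightV -Z3_double GRing.addrA.
have -> : y = linv x by case: x y xy1 xy2 => k [] [l []] //= ->.
by rewrite weight_cons letter_weightV GRing.addNKr.
Qed.

Lemma weight_lmul a u w : (weight a (lmul u w) = weight a u + weight a w)%R.
Proof.
elim: u => [|x u IH] /=; first by rewrite /weight big_nil GRing.add0r.
by rewrite weight_lcons IH weight_cons GRing.addrA.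
Qed.

Lemma weight_flip a w : (weight a (flip w) = - weight a w)%R.
Proof.
rewrite /weight big_map -GRing.sumrN.
by apply: eq_bigr => x _; apply: letter_weightV.
Qed.

(** The kernel of the homomorphism [p |-> (weight, bit)] to [Z/3 : Z/2], the symmetric group of
    degree 3. *)
Definition weight_kernel a p := ~~ (val p).2 && (weight a (val p).1 == 0%R).

Lemma weight_mul a p q :
  (weight a (val (p * q)%g).1
   = weight a (val p).1 + (-1) ^+ (val p).2 * weight a (val q).1)%R.
Proof.
rewrite /= weight_lmul; case: (val p).2 => /=; last by rewrite GRing.mul1r.
by rewrite weight_flip GRing.mulN1r.
Qed.

Lemma weight_kernelM a p q :
  weight_kernel a p -> weight_kernel a q -> weight_kernel a (p * q).
Proof.
case: p q => [[u b] ru] [[w c] rw] /andP[/= /negbTE-> /eqP wu] /andP[/= /negbTE-> /eqP ww].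
by rewrite /weight_kernel /= weight_lmul wu ww GRing.addr0 eqxx.
Qed.

Lemma weight_kernel1 a : weight_kernel a 1.
Proof. by rewrite /weight_kernel /= /weight big_nil eqxx. Qed.

Lemma weight_kernelV a p : weight_kernel a p -> weight_kernel a p^-1.
Proof.
case/andP=> p0 /eqP wp; have := weight_kernel1 a; rewrite -(mulVg p).
by rewrite /weight_kernel weight_mul wp GRing.mulr0 GRing.addr0 /= addbb /= (negbTE p0).
Qed.

Lemma weight_kernelJ a q p : weight_kernel a p -> weight_kernel a (p ^ q).
Proof.
case/andP=> /negbTE p0 /eqP wp; apply/andP; split.
  by rewrite /= p0; case: (val q).2.
(* With weight and bit zero, [p] drops out of [q^-1 p q], leaving the weight of [q^-1 q]. *)
rewrite conjgE !weight_mul wp p0 GRing.add0r GRing.mul1r -weight_mul mulVg.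
by case/andP: (weight_kernel1 a).
Qed.

(** * Homomorphisms preserving the weight kernels *)

(** The form in which normality enters: for an injective map, a kernel is its own image only if [p]
    and [F p] lie in it simultaneously. *)
Record star_normal_mono (F : star -> star) : Prop := {
  star_normal_monoM : {morph F : p q / p * q};
  star_normal_mono_inj : injective F;
  star_normal_mono_kernel : forall a p, weight_kernel a (F p) = weight_kernel a p
}.

Lemma star_normal_monoJ F h :
  star_normal_mono F -> star_normal_mono (fun p => F p ^ h).
Proof.
move=> [FM Fi Fn]; split=> [p q|p q /conjg_inj/Fi //|a p].
  by rewrite FM conjMg.
rewrite -(Fn a p); apply/idP/idP; last exact: weight_kernelJ.
by move/(weight_kernelJ h^-1); rewrite conjgK.
Qed.

(** Zero weights yield the free product itself as a kernel, whence [F] preserves the bit. *)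
Lemma weight_kernel_bit p : weight_kernel (fun=> 0%R) p = ~~ (val p).2.
Proof.
rewrite /weight_kernel /weight big1 ?eqxx ?andbT // => x _.
by rewrite /letter_weight GRing.oppr0; case: x.2.
Qed.

Lemma star_normal_mono_bit F p : star_normal_mono F -> (val (F p)).2 = (val p).2.
Proof.
by case=> _ _ /(_ (fun=> 0%R) p); rewrite !weight_kernel_bit => /(congr1 negb); rewrite !negbK.
Qed.

Lemma star_normal_mono_gens F :
  star_normal_mono F -> F flipper = flipper ->
  exists e, forall k, F (star_gen k) = star_letter (k, e).
Proof.
move=> NF Fs; have [FM Fi Fn] := NF.
have F1 : F 1 = 1 by rewrite -flipper2 FM Fs flipper2.
have Fc k : {x | F (star_gen k) = star_letter x}.
  (* A Boolean equation lets [sigW] extract a letter, so that the images define a function of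
     [k]. *)
  suff : exists x, F (star_gen k) == star_letter x.
    by move/sigW => [x /eqP]; exists x.
  have [||||x ->] := @cube_root_letter (F (star_gen k)).
  - by rewrite (star_normal_mono_bit _ NF).
  - by rewrite -!FM star_gen_cube.
  (* The relation [s c_k s = c_k^-1] is carried over by [F], which fixes [s]. *)
  - rewrite conjgE flipperV -{1 2}Fs -!FM.
    by apply/esym/mulg1_eq; rewrite -!FM -F1; congr F; apply: val_inj; rewrite /= eqxx.
  - by apply/eqP; rewrite -[X in _ <> X]F1 => /Fi.
  by exists x.
have [x {}Fc] : {x | forall k, F (star_gen k) = star_letter (x k)}.
  by exists (fun k => sval (Fc k)) => k; apply: svalP (Fc k).
have FV p : F p^-1 = (F p)^-1.
  by apply/esym/mulg1_eq; rewrite -FM mulgV F1.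
(* Weight supported at the index of the image: if that index were not [k], the kernel would contain
   [c_k] but not its image, of weight 1 or -1. *)
have x1 k : (x k).1 = k.
  apply: contraTeq isT => ne; pose a l : 'Z_3 := if l == (x k).1 then 1%R else 0%R.
  have : weight_kernel a (star_gen k).
    by rewrite /weight_kernel /= /weight big_seq1 /letter_weight /a /=
      [k == _]eq_sym (negbTE ne).
  rewrite -Fn Fc /weight_kernel /= /weight big_seq1 /letter_weight /a eqxx.
  by case: (x k).2.
(* With constant weight 1, [c_k c_l^-1] lies in the kernel, while opposite signs would give its
   image weight 2 or -2, nonzero modulo 3. *)
have x2 k l : (x k).2 = (x l).2.
  have [/(congr1 x) -> //|kl] := eqVneq k l; pose a (l : 'I_m) : 'Z_3 := 1%R.
  have xkl : ((x k).1 == (x l).1) = false by rewrite !x1 (negbTE kl).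
  have : weight_kernel a (star_gen k * (star_gen l)^-1).
    rewrite star_genV /weight_kernel /= (negbTE kl) /weight !big_cons big_nil.
    by rewrite /letter_weight /= GRing.addr0 GRing.subrr.
  rewrite -Fn FM FV !Fc star_letterV /weight_kernel /= xkl /weight !big_cons big_nil.
  by rewrite /letter_weight /= /a; case: (x k).2 (x l).2 => [] [].
(* Without generators either sign will do. *)
have [k0|no_k] := pickP 'I_m.
  by exists (x k0).2 => k; rewrite Fc (x2 k0 k) -{2}(x1 k) -surjective_pairing.
by exists true => k; have := no_k k.
Qed.

Lemma star_normal_mono_inner F :
  star_normal_mono F -> exists h, forall p, F p = p ^ h.
Proof.
move=> NF; have [FM Fi Fn] := NF.
have F1 : F 1 = 1 by apply: (@mulgI _ (F 1)); rewrite -FM !mulg1.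
have Fs2 : F flipper * F flipper = 1 by rewrite -FM flipper2.
have Fsbit : (val (F flipper)).2.
  by rewrite (star_normal_mono_bit _ NF).
have [h def_Fs] := involution_conj_flipper Fsbit Fs2.
have NG := star_normal_monoJ h^-1 NF.
have Gs : F flipper ^ h^-1 = flipper by rewrite def_Fs conjgK.
have [[] Gc] := star_normal_mono_gens NG Gs.
  exists h => p; apply: (canRL (conjgKV h)).
  exact: (star_hom_id (star_normal_monoM NG)).
(* All generators are inverted here; conjugation by the flipper undoes this. *)
have NG' := star_normal_monoJ flipper NG.
exists (flipper * h) => p; rewrite conjgM; apply: (canRL (conjgKV h)).
apply: (canRL (conjgKV flipper)); rewrite flipperV.
apply: (star_hom_id (star_normal_monoM NG')) => [|k].
  by rewrite Gs; apply: val_inj.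
by rewrite Gc star_letterJ star_letterV.
Qed.

End StarAutomorphisms.

(** * Identification with [L_n] *)

Section WordEquality.
Variable m : nat.
Local Notation Leq_L := (@Leq m.+2).
Implicit Types u v w : seq 'I_m.+1.

Lemma Leq_refl w : Leq_L w w. Proof. exact: rst_refl. Qed.

Lemma Leq_sym u v : Leq_L u v -> Leq_L v u. Proof. exact: rst_sym. Qed.

Lemma Leq_trans v u w : Leq_L u v -> Leq_L v w -> Leq_L u w.
Proof. exact: rst_trans. Qed.

Lemma Lstep_cat a b u v : @Lstep m.+2 u v -> @Lstep m.+2 (a ++ u ++ b) (a ++ v ++ b).
Proof.
case=> [c d i|c d i j ij].
  have := @Lstep_sq m.+2 (a ++ c) (d ++ b) i; by rewrite -!catA.
have := @Lstep_braid m.+2 (a ++ c) (d ++ b) i j ij; by rewrite -!catA.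
Qed.

Lemma Leq_catlr a b u v : Leq_L u v -> Leq_L (a ++ u ++ b) (a ++ v ++ b).
Proof.
elim=> [{}u {}v uv|{}u|{}u {}v _|{}u w {}v _ IHu _ IHv].
- exact/rst_step/Lstep_cat.
- exact: Leq_refl.
- exact: Leq_sym.
- exact: Leq_trans IHu IHv.
Qed.

Lemma Leq_cat u u' v v' : Leq_L u u' -> Leq_L v v' -> Leq_L (u ++ v) (u' ++ v').
Proof.
move=> uu' vv'; apply: (@Leq_trans (u' ++ v)).
  exact: (Leq_catlr [::] v uu').
by have := Leq_catlr u' [::] vv'; rewrite !cats0.
Qed.

Lemma Leq_sq (i : 'I_m.+1) w : Leq_L (i :: i :: w) w.
Proof. exact/rst_step/(@Lstep_sq m.+2 [::] w i). Qed.

Lemma Leq_braid (i j : 'I_m.+1) w :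
  val j = (val i).+1 -> Leq_L (i :: j :: i :: w) (j :: i :: j :: w).
Proof. by move=> ij; apply/rst_step/(@Lstep_braid m.+2 [::] w i j ij). Qed.

#[export] Instance Leq_equivalence : Equivalence Leq_L.
Proof. by split; [exact: Leq_refl|exact: Leq_sym|move=> u v w; exact: Leq_trans]. Qed.

#[export] Instance Leq_cat_Proper : Proper (Leq_L ==> Leq_L ==> Leq_L) (@cat 'I_m.+1).
Proof. by move=> u u' uu' v v' vv'; apply: Leq_cat. Qed.

#[export] Instance Leq_cons_Proper (i : 'I_m.+1) : Proper (Leq_L ==> Leq_L) (cons i).
Proof. by move=> v v'; apply: (@Leq_cat [:: i] [:: i]); apply: Leq_refl. Qed.

Lemma Leq_revK u w : Leq_L (rev u ++ u ++ w) w.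
Proof.
elim: u w => [|i u IH] w; first reflexivity.
by rewrite rev_cons cat_rcons /= Leq_sq.
Qed.

Lemma Leq_revVK u w : Leq_L (u ++ rev u ++ w) w.
Proof. by have := Leq_revK (rev u) w; rewrite revK. Qed.

Lemma Leq_revr u : Leq_L (u ++ rev u) [::].
Proof. by have := Leq_revVK u [::]; rewrite cats0. Qed.

(** Reversal is inversion, so [rev u = rev u u rev v = rev v] in [L_n]. *)
#[export] Instance Leq_rev_Proper : Proper (Leq_L ==> Leq_L) (@rev 'I_m.+1).
Proof.
move=> u v uv; apply: (@Leq_trans (rev u ++ u ++ rev v)); last exact: Leq_revK.
rewrite -[X in Leq_L X _]cats0; apply: Leq_cat; first exact: Leq_refl.
by apply: Leq_sym; rewrite uv; apply: Leq_revr.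
Qed.

End WordEquality.

#[local] Hint Resolve Leq_refl : core.

(** * The homomorphism from [L_n] to the semidirect product *)

Section StarPresentation.
Variable m : nat.
Local Open Scope group_scope.

Local Notation word := (seq 'I_m.+1).
Local Notation star := (star m).
Local Notation Leq_L := (@Leq m.+2).
Local Notation y i := (inord i : 'I_m.+1).
Implicit Types (u v w : word) (p q : star).

(** Indexing by [nat], with value 1 from [m] on, allows recursion over prefixes. *)
Definition star_nat (i : nat) : star := oapp (@star_gen m) 1 (insub i).

Fixpoint star_prefix i : star :=
  if i is j.+1 then star_prefix j * star_nat j else 1.

Definition star_refl (i : 'I_m.+1) : star := flipper m ^ (star_prefix i)^-1.

Definition to_star w : star := foldr (fun i p => star_refl i * p) 1 w.

Lemma star_natE i (lt_im : i < m) : star_nat i = star_gen (Ordinal lt_im).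
Proof. by rewrite /star_nat insubT. Qed.

Lemma to_star_cat u v : to_star (u ++ v) = to_star u * to_star v.
Proof. by elim: u => [|i u IH] /=; rewrite ?mul1g // IH mulgA. Qed.

Lemma star_refl2 i : star_refl i * star_refl i = 1.
Proof. by rewrite -conjMg flipper2 conj1g. Qed.

Lemma flipper_genJ (k : 'I_m) :
  flipper m * flipper m ^ (star_gen k)^-1 = star_gen k.
Proof. by apply: val_inj; rewrite /= !eqxx. Qed.

Lemma star_refl_step (i j : 'I_m.+1) : val j = (val i).+1 ->
  star_refl j = (flipper m ^ (star_nat i)^-1) ^ (star_prefix i)^-1.
Proof. by move=> ij; rewrite /star_refl ij /= invgM conjgM. Qed.

(** Since [s (c s c^-1) = c], the product of neighbouring involutions is a conjugate of a generator
    and has order 3, which is the braid relation. *)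
Lemma star_refl_pair (i j : 'I_m.+1) : val j = (val i).+1 ->
  star_refl i * star_refl j = star_nat i ^ (star_prefix i)^-1.
Proof.
move=> ij; have lt_im : i < m by have := ltn_ord j; rewrite [nat_of_ord j]ij ltnS.
by rewrite (star_refl_step ij) -conjMg star_natE flipper_genJ.
Qed.

Lemma star_refl_braid (i j : 'I_m.+1) : val j = (val i).+1 ->
  star_refl i * (star_refl j * star_refl i) = star_refl j * (star_refl i * star_refl j).
Proof.
move=> ij; have lt_im : i < m by have := ltn_ord j; rewrite [nat_of_ord j]ij ltnS.
apply/divg1_eq; rewrite (invgM (star_refl j)) (invgM (star_refl i)).
have V l : (star_refl l)^-1 = star_refl l by apply/mulg1_eq/star_refl2.
(* The quotient of the two sides of the braid relation is [r^3]. *)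
pose r := star_refl i * star_refl j.
rewrite !V; transitivity (r * r * r); first by rewrite /r !mulgA.
by rewrite /r (star_refl_pair ij) -!conjMg star_natE star_gen_cube conj1g.
Qed.

Lemma to_star_Leq u v : Leq_L u v -> to_star u = to_star v.
Proof.
elim=> [_ _ [a b i|a b i j ij]|//|{}u {}v _ ->//|{}u w {}v _ -> _ ->//].
  by rewrite !to_star_cat /= mulg1 star_refl2 mul1g.
by rewrite !to_star_cat /= !mulg1 (star_refl_braid ij).
Qed.

Lemma to_star_rev w : to_star (rev w) = (to_star w)^-1.
Proof.
by apply/esym/mulg1_eq; rewrite -to_star_cat (to_star_Leq (Leq_revr w)).
Qed.

(** * The inverse homomorphism *)

(** With [P_i = c_0 ... c_(i-1)], one has [P_(i+1) = (P_i c_i P_i^-1) P_i = y_i y_(i+1) P_i], and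
    [gen_word] solves this for [c_i]. *)
Fixpoint prefix_word i : word :=
  if i is j.+1 then [:: y j, y j.+1 & prefix_word j] else [::].

Definition gen_word i : word := rev (prefix_word i) ++ [:: y i, y i.+1 & prefix_word i].

Lemma val_y_succ i : i < m -> val (y i.+1) = (val (y i)).+1.
Proof. by move=> lt_im; rewrite /= !inordK // ltnW. Qed.

Lemma Leq_ybraid i w : i < m ->
  Leq_L (y i :: y i.+1 :: y i :: w) (y i.+1 :: y i :: y i.+1 :: w).
Proof. by move=> lt_im; apply/Leq_braid/val_y_succ. Qed.

(** Induction on [i]: the braid relation turns [y_i y_(i+1) y_i y_(i+1) y_i] into [y_(i+1)]. *)
Lemma prefix_word_conj i w : i <= m ->
  Leq_L (prefix_word i ++ ord0 :: rev (prefix_word i) ++ w) (y i :: w).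
Proof.
elim: i w => [|i IH] w le_im.
  rewrite /=; have -> : y 0 = ord0 by apply: val_inj; rewrite /= inordK.
  reflexivity.
rewrite /= !rev_cons !cat_rcons IH 1?ltnW //.
by rewrite Leq_ybraid // !Leq_sq.
Qed.

Lemma to_star_prefix i : i <= m -> to_star (prefix_word i) = star_prefix i.
Proof.
elim: i => //= i IH lt_im; rewrite IH 1?ltnW // mulgA.
rewrite (star_refl_pair (val_y_succ lt_im)) [nat_of_ord _]inordK 1?ltnW //.
by rewrite conjgE invgK mulgA mulgVK.
Qed.

Lemma to_star_gen (k : 'I_m) : to_star (gen_word k) = star_gen k.
Proof.
rewrite to_star_cat to_star_rev /= to_star_prefix 1?ltnW // (mulgA (star_refl _)).
rewrite (star_refl_pair (val_y_succ (ltn_ord k))) [nat_of_ord (inord k)]inordK ?ltnS 1?ltnW //.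
rewrite conjgE invgK !mulgA mulVg mul1g mulgVK star_natE.
by congr star_gen; apply: val_inj.
Qed.

Lemma gen_word_cube i w : i < m ->
  Leq_L (gen_word i ++ gen_word i ++ gen_word i ++ w) w.
Proof.
move=> lt_im; rewrite /gen_word -!catA /= !Leq_revVK.
by rewrite Leq_ybraid // !Leq_sq Leq_revK.
Qed.

(** In [L_n], [y_0] inverts [c_i]: moving both copies of [y_0] past [P_i] turns them into [y_i], so
    [P_i^-1 y_i y_i y_(i+1) y_i P_i = P_i^-1 y_(i+1) y_i P_i]. *)
Lemma gen_wordJ i w : i < m ->
  Leq_L (ord0 :: gen_word i ++ ord0 :: w) (rev (gen_word i) ++ w).
Proof.
move=> lt_im; have le_im := ltnW lt_im; rewrite /gen_word -!catA /=.
have -> : Leq_L (ord0 :: rev (prefix_word i) ++ y i :: y i.+1 :: prefix_word i ++ ord0 :: w)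
   (rev (prefix_word i) ++ y i :: y i :: y i.+1 :: prefix_word i ++ ord0 :: w).
  by rewrite -[X in Leq_L X _](Leq_revK (prefix_word i)) prefix_word_conj.
rewrite Leq_sq -{1}(Leq_revK (prefix_word i) w) prefix_word_conj //.
rewrite rev_cat !rev_cons revK -!cats1 -!catA /=.
reflexivity.
Qed.

Definition letter_word (x : 'I_m * bool) : word :=
  if x.2 then gen_word x.1 else rev (gen_word x.1).

Definition of_free (u : seq ('I_m * bool)) : word := flatten (map letter_word u).

(** The flipper goes to [ord0], the generator with empty prefix. *)
Definition of_star p : word :=
  of_free (val p).1 ++ (if (val p).2 then [:: ord0] else [::]).

Lemma letter_wordV x : letter_word (linv x) = rev (letter_word x).
Proof. by case: x => k [] //=; rewrite /letter_word /= revK. Qed.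

Lemma letter_word_sq x w :
  Leq_L (letter_word x ++ letter_word x ++ w) (letter_word (linv x) ++ w).
Proof.
have cube k v := gen_word_cube v (ltn_ord k).
case: x => k [] /=; rewrite /letter_word /=.
  by rewrite -{1}(Leq_revK (gen_word k) (_ ++ _)) cube.
by rewrite -{1}(cube k w) !Leq_revK.
Qed.

Lemma letter_wordJ x w :
  Leq_L (ord0 :: letter_word x ++ w) (letter_word (linv x) ++ ord0 :: w).
Proof.
case: x => k []; rewrite /letter_word /= ?revK.
  by rewrite -{1}(Leq_sq ord0 w) gen_wordJ.
by rewrite -gen_wordJ // Leq_sq.
Qed.

Lemma of_free_lcons x (s : seq ('I_m * bool)) :
  Leq_L (of_free (lcons x s)) (letter_word x ++ of_free s).
Proof.
case: s => [|z s]; first by [].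
rewrite /=; case: eqP => // xz1.
case: eqP => xz2.
  have -> : z = x by case: x z xz1 xz2 => k e [l d] /= -> ->.
  by rewrite /of_free /= letter_word_sq.
have -> : z = linv x by case: x z xz1 xz2 => k [] [l []] //= ->.
by rewrite /of_free /= letter_wordV Leq_revVK.
Qed.

Lemma of_free_lmul (s t : seq ('I_m * bool)) :
  Leq_L (of_free (lmul s t)) (of_free s ++ of_free t).
Proof.
elim: s => [|x s IH] /=; first by [].
by rewrite of_free_lcons IH /of_free /= catA.
Qed.

Lemma of_free_flip (s : seq ('I_m * bool)) w :
  Leq_L (ord0 :: of_free s ++ w) (of_free (flip s) ++ ord0 :: w).
Proof.
elim: s w => [|x s IH] w /=; first by [].
by rewrite /of_free /= -!catA letter_wordJ IH.
Qed.

Lemma of_starM p q : Leq_L (of_star (p * q)) (of_star p ++ of_star q).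
Proof.
case: p q => [[u b] ru] [[v c] rv]; rewrite /of_star /= of_free_lmul -!catA.
case: b {ru} => //=.
rewrite of_free_flip; case: c {rv} => //=.
by rewrite Leq_sq.
Qed.

Lemma of_starV p : Leq_L (of_star p^-1) (rev (of_star p)).
Proof.
rewrite -[X in Leq_L X _]cats0 -(Leq_revr (of_star p)) catA -of_starM mulVg.
reflexivity.
Qed.

Lemma of_star_gen k : of_star (star_gen k) = gen_word k.
Proof. by rewrite /of_star /of_free /= !cats0. Qed.

Lemma of_star_prefix i : i <= m -> Leq_L (of_star (star_prefix i)) (prefix_word i).
Proof.
elim: i => [|i IH] lt_im /=; first by [].
rewrite of_starM IH 1?ltnW // star_natE of_star_gen /gen_word /= Leq_revVK.
reflexivity.
Qed.

Lemma of_star_refl i : Leq_L (of_star (star_refl i)) [:: i].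
Proof.
have le_im : i <= m by rewrite -ltnS.
rewrite /star_refl conjgE invgK !of_starM of_starV of_star_prefix //.
have := prefix_word_conj [::] le_im; rewrite cats0 inord_val.
by [].
Qed.

Lemma to_starK w : Leq_L (of_star (to_star w)) w.
Proof.
elim: w => [|i w IH] /=; first by [].
by rewrite of_starM of_star_refl IH.
Qed.

(** The composite is an endomorphism fixing the flipper and all generators. *)
Lemma of_starK p : to_star (of_star p) = p.
Proof.
apply: (star_hom_id (F := to_star \o of_star)) => [{}p q||k] /=.
- by rewrite (to_star_Leq (of_starM p q)) to_star_cat.
- by rewrite /star_refl /= invg1 conjg1 mulg1.
- by rewrite of_star_gen to_star_gen.
Qed.

Lemma to_star_inj u v : to_star u = to_star v -> Leq_L u v.
Proof. by move=> uv; rewrite -(to_starK u) uv to_starK. Qed.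

Lemma to_star_Lconj g w : to_star (@Lconj m.+2 g w) = to_star w ^ (to_star g)^-1.
Proof. by rewrite !to_star_cat to_star_rev conjgE invgK. Qed.

(** * Transport of normal automorphisms *)

Lemma weight_kernel_Lnormal a : @Lnormal m.+2 (fun w => weight_kernel a (to_star w)).
Proof.
split; first by move=> u v /to_star_Leq ->.
split; first exact: weight_kernel1.
split; first by move=> u v Ku Kv; rewrite to_star_cat; apply: weight_kernelM.
split; first by move=> u Ku; rewrite to_star_rev; apply: weight_kernelV.
by move=> g u Ku; rewrite to_star_Lconj; apply: weight_kernelJ.
Qed.

Lemma Lnormal_auto_star (f : Lword m.+2 -> Lword m.+2) :
  Lnormal_auto f -> star_normal_mono (fun p => to_star (f (of_star p))).
Proof.
case=> [[f_Leq [f_cat [g [g_Leq [gK _]]]]] f_normal].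
have f_inj u v : Leq_L (f u) (f v) -> Leq_L u v.
  by move=> fuv; rewrite -(gK u) -(gK v); apply: g_Leq.
split=> [p q|p q pq|a p].
- by rewrite (to_star_Leq (f_Leq _ _ (of_starM p q))) (to_star_Leq (f_cat _ _)) to_star_cat.
- by rewrite -(of_starK p) -(of_starK q); apply/to_star_Leq/f_inj/to_star_inj.
(* Any [v] in the kernel with [f v = f (of_star p)] in [L_n] represents [p], by injectivity of
   [f]. *)
have [Nf fN] := f_normal _ (weight_kernel_Lnormal a) (f (of_star p)).
apply/idP/idP => [/Nf[v Nv /f_inj/to_star_Leq vp]|Kp].
  by rewrite -(of_starK p) -vp.
apply: fN; exists (of_star p); first by rewrite of_starK.
exact: Leq_refl.
Qed.

Lemma Lnormal_auto_inner (f : Lword m.+2 -> Lword m.+2) : Lnormal_auto f -> Linner f.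
Proof.
move=> Nf; have [h def_f] := star_normal_mono_inner (Lnormal_auto_star Nf).
(* [Lconj g w] is [g w g^-1], whereas [p ^ h] is [h^-1 p h]; hence the inverse. *)
exists (of_star h^-1) => w; apply: to_star_inj.
rewrite to_star_Lconj of_starK invgK -def_f.
by apply/to_star_Leq; case: Nf => [[f_Leq _] _]; apply/f_Leq/Leq_sym/to_starK.
Qed.

End StarPresentation.

Theorem theorem5p6 (n : nat) (hn : 2 <= n) (f : Lword n -> Lword n) :
  Lnormal_auto f -> Linner f.
Proof. by case: n hn f => [|[|m]] // _ f; apply: Lnormal_auto_inner. Qed.
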